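(* Let $G=(V,E)$ be a finite simple undirected graph, $c:E\to\mathbb{R}_{\ge 0}$ a capacity function, $s,t\in V$, and $w\in\mathbb{R}$. Let $S_w\subseteq\{0,1\}^E$ be the set of orientations $f$ of $G$ such that the digraph $\vec G^f$ (with capacities $c$) admits an $s$-$t$ flow of value at least $w$. Then $S_w$ is shattering-extremal.
   Context: Fix an arbitrary reference direction for each edge of $G$. An orientation of $G$ is a function $f\in\{0,1\}^E$; $\vec G^f$ is the digraph obtained by directing each edge $e$ along its reference direction if $f(e)=0$ and against it if $f(e)=1$. For disjoint sets $A,B$ and $g\in\{0,1\}^A$, $h\in\{0,1\}^B$, $g\star h\in\{0,1\}^{A\cup B}$ is the function agreeing with $g$ on $A$ and with $h$ on $B$. For $S\subseteq\{0,1\}^E$ and $Y\subseteq E$: $S$ shatters $Y$ if for every $h\in\{0,1\}^Y$ there exists $g\in\{0,1\}^{E\setminus Y}$ with $g\star h\in S$; $S$ strongly shatters $Y$ if there exists $g\in\{0,1\}^{E\setminus Y}$ such that $g\star h\in S$ for every $h\in\{0,1\}^Y$. $S$ is shattering-extremal if the family of sets shattered by $S$ equals the family of sets strongly shattered by $S$. *)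

(* Defs.v *)
From HB Require Import structures.
From mathcomp Require Import all_boot all_order all_algebra.
From mathcomp Require Import classical_sets reals.
Set Implicit Arguments.
Unset Strict Implicit.
Unset Printing Implicit Defensive.
Import Order.TTheory GRing.Theory Num.Theory.
Local Open Scope ring_scope.

Section Shattering.
Variable T : finType.

Definition star (Y : {set T}) (g : {ffun {x : T | x \notin Y} -> bool})
    (h : {ffun {x : T | x \in Y} -> bool}) : {ffun T -> bool} :=
  [ffun x => match boolP (x \in Y) with
             | AltTrue xY => h (exist _ x xY)
             | AltFalse xNY => g (exist _ x xNY)
             end].

Definition shatters (S : set {ffun T -> bool}) (Y : {set T}) : Prop :=
  forall h : {ffun {x : T | x \in Y} -> bool},
  exists g : {ffun {x : T | x \notin Y} -> bool}, S (star g h).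

Definition strongly_shatters (S : set {ffun T -> bool}) (Y : {set T}) : Prop :=
  exists g : {ffun {x : T | x \notin Y} -> bool},
  forall h : {ffun {x : T | x \in Y} -> bool}, S (star g h).

Definition shattering_extremal (S : set {ffun T -> bool}) : Prop :=
  [set Y | shatters S Y]%classic = [set Y | strongly_shatters S Y]%classic.

End Shattering.

(* A digraph on V is given by a finite type A of arcs and a map sending each
   arc to the pair (tail, head). *)
Section Flow.
Variables (R : realType) (V A : finType) (arc : A -> V * V) (c : A -> R).

Definition outflow (phi : A -> R) (v : V) : R :=
  \sum_(a | (arc a).1 == v) phi a.

Definition inflow (phi : A -> R) (v : V) : R :=
  \sum_(a | (arc a).2 == v) phi a.

Definition is_flow (s t : V) (phi : A -> R) : Prop :=
  (forall a, 0 <= phi a <= c a) /\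
  (forall v, v != s -> v != t -> inflow phi v = outflow phi v).

Definition flow_value (s : V) (phi : A -> R) : R :=
  outflow phi s - inflow phi s.

End Flow.

Section Orientation.
Variables (V : finType) (E : {set {set V}}).

Definition simple_graph : Prop := forall e, e \in E -> #|e| = 2%N.

Definition edge : finType := {e : {set V} | e \in E}.

Definition reference_direction (ref : edge -> V * V) : Prop :=
  forall e, val e = [set (ref e).1; (ref e).2]%SET.

Definition orient (ref : edge -> V * V) (f : {ffun edge -> bool}) (e : edge) :
    V * V :=
  if f e then ((ref e).2, (ref e).1) else ref e.

Definition flow_orientations (R : realType) (ref : edge -> V * V)
    (c : edge -> R) (s t : V) (w : R) : set {ffun edge -> bool} :=
  [set f | exists phi : edge -> R,
     is_flow (orient ref f) c s t phi /\
     w <= flow_value (orient ref f) s phi]%classic.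

End Orientation.

(* Main.v *)
Require Import Defs.
From HB Require Import structures.
From mathcomp Require Import all_boot all_order all_algebra.
From mathcomp Require Import classical_sets reals.
From mathcomp Require Import ring lra.
Set Implicit Arguments.
Unset Strict Implicit.
Unset Printing Implicit Defensive.
Import Order.TTheory GRing.Theory Num.Theory.
Local Open Scope ring_scope.

(** Record a flow in an orientation as a signed flow along the reference
    directions. The signed flows of value at least [w] respecting the capacities
    form a convex set [K] that does not depend on the orientation, and an
    orientation lies in [S_w] iff [K] meets the corresponding closed orthant.
    If [S_w] shatters [Y], the projection of the convex set [K] to [R^Y] meets
    every closed orthant, hence contains [0]. A point of [K] vanishing on [Y]
    lies in all the orthants that agree with its signs off [Y], so these signs
    witness that [S_w] strongly shatters [Y]. *)

Section Orthants.
Variables (R : realType) (T : finType).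
Implicit Types (K : set (T -> R)) (x y : T -> R) (Y : {set T}).

Definition convex_fun_set K : Prop :=
  forall (a : R) x y, 0 <= a <= 1 -> K x -> K y ->
  K (fun e => a * x e + (1 - a) * y e).

(** The orthants are closed: 0 fits both signs, so a vanishing coordinate leaves the orientation of
    its edge free. *)
Definition sign_compatible (b : bool) (r : R) : bool :=
  if b then r <= 0 else 0 <= r.

Definition orthants_meeting K : set {ffun T -> bool} :=
  [set f | exists2 x, K x & forall e, sign_compatible (f e) (x e)]%classic.

Lemma sign_compatible0 b : sign_compatible b 0.
Proof. by case: b => /=. Qed.

Lemma sign_compatible_lt0 r : sign_compatible (r < 0) r.
Proof. by rewrite /sign_compatible; case: ltP => // /ltW. Qed.

Lemma sign_compatible_conv b (a r q : R) : 0 <= a <= 1 ->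
  sign_compatible b r -> sign_compatible b q ->
  sign_compatible b (a * r + (1 - a) * q).
Proof. by case: b => /= /andP[a0 a1] hr hq; nra. Qed.

Lemma conv_coef_eq0 (r q : R) : r <= 0 -> 0 <= q ->
  exists2 a, 0 <= a <= 1 & a * r + (1 - a) * q = 0.
Proof.
move=> r0 q0; have [/eqP E|qr] := eqVneq (q - r) 0.
  (* Here [r] and [q] are both 0, so any coefficient would do. *)
  by exists 1; [rewrite ler01 lexx | move/eqP: E; lra].
have qr_gt0 : 0 < q - r by rewrite lt_neqAle eq_sym qr; lra.
exists (q / (q - r)); last by field.
by rewrite (divr_ge0 q0 (ltW qr_gt0)) ler_pdivrMr //; lra.
Qed.

(* Induction on coordinates: combining points with opposite signs at [e] shows
   that the slice [x e = 0] of [K] still meets every orthant. *)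
Lemma convex_orthants_zero (r : seq T) K : convex_fun_set K ->
  (forall h : T -> bool,
     exists2 x, K x & {in r, forall e, sign_compatible (h e) (x e)}) ->
  exists2 x, K x & {in r, forall e, x e = 0}.
Proof.
elim: r K => [|e r IHr] K convK meetK.
  by have [x Kx _] := meetK xpredT; exists x.
have [||x [Kx xe0] xr0] := IHr [set x | K x /\ x e = 0]%classic.
- move=> a x y a01 [Kx xe0] [Ky ye0]; split; first exact: convK.
  by rewrite xe0 ye0 !mulr0 addr0.
- move=> h.
  have [x Kx xP] := meetK [eta h with e |-> true].
  have [y Ky yP] := meetK [eta h with e |-> false].
  have xe0 : x e <= 0 by have := xP e (mem_head _ _); rewrite /= eqxx.
  have ye0 : 0 <= y e by have := yP e (mem_head _ _); rewrite /= eqxx.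
  have [a a01 ae0] := conv_coef_eq0 xe0 ye0.
  exists (fun i => a * x i + (1 - a) * y i); first by split=> //; exact: convK.
  (* The tail [r] may contain [e] again; the combination is 0 there, which fits any sign. *)
  move=> i ri; have [->|ie] := eqVneq i e.
    by rewrite ae0 sign_compatible0.
  have ir : i \in e :: r by rewrite inE ri orbT.
  have := xP i ir; have := yP i ir; rewrite /= (negPf ie) => hy hx.
  exact: sign_compatible_conv.
- exists x => // i; rewrite inE => /predU1P[->//|]; exact: xr0.
Qed.

Lemma star_in Y g h e (eY : e \in Y) : star g h e = h (exist _ e eY).
Proof.
rewrite ffunE; case: {-}_ / boolP => eY'; last by exfalso; rewrite eY in eY'.
(* The match in [star] carries its own membership proof, which [val_inj] identifies with [eY]. *)
by congr (h _); exact: val_inj.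
Qed.

Lemma star_notin Y g h e (eY : e \notin Y) : star g h e = g (exist _ e eY).
Proof.
rewrite ffunE; case: {-}_ / boolP => eY'; first by exfalso; rewrite eY' in eY.
by congr (g _); exact: val_inj.
Qed.

Lemma strongly_shatters_shatters (S : set {ffun T -> bool}) Y :
  strongly_shatters S Y -> shatters S Y.
Proof. by case=> g gP h; exists g. Qed.

Lemma shattering_extremal_orthants K :
  convex_fun_set K -> shattering_extremal (orthants_meeting K).
Proof.
move=> convK; apply/seteqP; split=> Y; last exact: strongly_shatters_shatters.
move=> shY.
have [|x Kx x0] := @convex_orthants_zero (enum Y) K convK.
  move=> h; have [g [x Kx xP]] := shY [ffun u => h (val u)].
  exists x => // e; rewrite mem_enum => eY.
  by have := xP e; rewrite (star_in _ _ eY) ffunE.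
exists [ffun u => x (val u) < 0] => h; exists x => // e.
have [eY|eY] := boolP (e \in Y).
  by rewrite x0 ?mem_enum // sign_compatible0.
by rewrite (star_notin _ _ eY) ffunE sign_compatible_lt0.
Qed.

End Orthants.

Section SignedFlows.
Variables (R : realType) (V A : finType).
Implicit Types (arc : A -> V * V) (phi x y : A -> R).

(** One linear functional serves both for conservation at inner vertices and, at [s], for the flow
    value. *)
Definition excess arc x (v : V) : R := outflow arc x v - inflow arc x v.

Lemma excess_conv arc (a : R) x y v :
  excess arc (fun e => a * x e + (1 - a) * y e) v =
  a * excess arc x v + (1 - a) * excess arc y v.
Proof.
rewrite /excess /outflow /inflow !big_split -!mulr_sumr /=; ring.
Qed.

Definition signed_flows arc (c : A -> R) (s t : V) (w : R) : set (A -> R) :=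
  [set x | [/\ forall e, `|x e| <= c e,
               forall v, v != s -> v != t -> excess arc x v = 0
             & w <= excess arc x s]]%classic.

Lemma convex_signed_flows arc c s t w :
  convex_fun_set (signed_flows arc c s t w).
Proof.
move=> a x y a01 [xc x0 xw] [yc y0 yw]; have /andP[a0 a1] := a01; split.
- move=> e; have := xc e; have := yc e; rewrite !ler_norml.
  by move=> /andP[? ?] /andP[? ?]; apply/andP; split; nra.
- by move=> v vs vt; rewrite excess_conv x0 // y0 // !mulr0 addr0.
- by rewrite excess_conv; nra.
Qed.

End SignedFlows.

Section OrientationFlows.
Variables (R : realType) (V : finType) (E : {set {set V}}).
Variable ref : edge E -> V * V.

(** Reversing an arc swaps its contributions to outflow and inflow, which amounts to negating the
    flow on it. *)
Lemma excess_orient (f : {ffun edge E -> bool}) (x : edge E -> R) v :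
  excess (orient ref f) x v =
  excess ref (fun e => if f e then - x e else x e) v.
Proof.
rewrite /excess /outflow /inflow !(big_mkcond (fun a => _ == v)) -!sumrB.
apply: eq_bigr => e _; rewrite /orient.
by case: (f e) => //=; do 2!case: ifP => _; ring.
Qed.

Lemma flow_orientationsE (c : edge E -> R) s t w :
  flow_orientations ref c s t w =
  orthants_meeting (signed_flows ref c s t w).
Proof.
apply/seteqP; split=> f /=.
  move=> [phi [[phic phi0] phiw]].
  exists (fun e => if f e then - phi e else phi e).
    split=> [e|v vs vt|].
    - have /andP[p0 pc] := phic e.
      by case: (f e); rewrite ?normrN ger0_norm.
    - by rewrite -excess_orient /excess phi0 // subrr.
    - by rewrite -excess_orient.
  move=> e; have /andP[p0 _] := phic e.
  by case: (f e); rewrite /= ?oppr_le0.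
move=> [x [xc x0 xw] xf].
(* By sign compatibility, negating [|x e|] exactly on the reversed edges gives back [x e]. *)
have exc v : excess (orient ref f) (fun e => `|x e|) v = excess ref x v.
  rewrite excess_orient; congr (_ - _); apply: eq_bigr => e _;
  by have := xf e; case: (f e) => /= h; rewrite ?(ler0_norm h) ?(ger0_norm h) ?opprK.
exists (fun e => `|x e|); split; last by rewrite -exc in xw.
split=> [e|v vs vt]; first by rewrite normr_ge0 xc.
by apply/esym/eqP; rewrite -subr_eq0 -/(excess _ _ _) exc x0.
Qed.

End OrientationFlows.

Theorem theorem4p1 (R : realType) (V : finType) (E : {set {set V}})
    (hG : simple_graph E) (ref : edge E -> V * V)
    (href : reference_direction ref) (c : edge E -> R)
    (hc : forall e, 0 <= c e) (s t : V) (w : R) :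
  shattering_extremal (flow_orientations ref c s t w).
Proof.
rewrite flow_orientationsE.
exact/shattering_extremal_orthants/convex_signed_flows.
Qed.
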